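(* Let $k\ge1$, let $\alpha_1,\dots,\alpha_k>-1$ and $\beta_1,\dots,\beta_k$ be real, and put $\gamma_j=\alpha_{j+1}+\alpha_{j+2}+\dots+\alpha_k+\beta_j+\beta_{j+1}+\dots+\beta_k+(k-j)$ for $j=1,\dots,k$; assume $\gamma_j>0$ for all $j$. Let $(x_1,\dots,x_k)$ have the joint density $$f_1(x_1,\dots,x_k)=C_1\,x_1^{\alpha_1}(1-x_1)^{\beta_1}x_2^{\alpha_2}(1-x_1-x_2)^{\beta_2}\cdots x_k^{\alpha_k}(1-x_1-\dots-x_k)^{\beta_k-1}$$ on $\{x_j>0,\ 0<x_1+\dots+x_j<1,\ j=1,\dots,k\}$ and $0$ elsewhere, where $C_1$ is the normalizing constant. Let $(v_1,\dots,v_k)$ be a vector of positive real random variables with an arbitrary joint density $f(v_1,\dots,v_k)$ on $(0,\infty)^k$, independent of $(x_1,\dots,x_k)$. Let $$u_j=v_j\,\frac{x_j}{1-x_1-\dots-x_{j-1}},\quad j=1,\dots,k$$ (for $j=1$ the denominator is $1$), and let $g(u_1,\dots,u_k)$ be the joint density of $(u_1,\dots,u_k)$. Then, for (almost every) $(u_1,\dots,u_k)\in(0,\infty)^k$, $$\Big\{\prod_{j=1}^k\frac{\Gamma(\alpha_j+1)}{\Gamma(\alpha_j+\gamma_j+1)}\Big\}g(u_1,\dots,u_k)=K_{u_j,j=1,\dots,k}^{(\alpha_j,\gamma_j),j=1,\dots,k}f(u_1,\dots,u_k).$$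
   Context: The multivariable Kober fractional integral operator of the second kind is defined, for parameters $\zeta_j$ and $\alpha_j>0$, by $$K_{u_j,j=1,\dots,k}^{(\zeta_j,\alpha_j),j=1,\dots,k}f(u_1,\dots,u_k)=\Big\{\prod_{j=1}^k\frac{u_j^{\zeta_j}}{\Gamma(\alpha_j)}\Big\}\int_{v_1>u_1}\cdots\int_{v_k>u_k}\Big\{\prod_{j=1}^k(v_j-u_j)^{\alpha_j-1}v_j^{-\zeta_j-\alpha_j}\Big\}f(v_1,\dots,v_k)\,dv_1\cdots dv_k;$$ here it is applied with $\zeta_j=\alpha_j$ and $\alpha_j$ replaced by $\gamma_j$. *)

(* Defs.v *)
From HB Require Import structures.
From mathcomp Require Import all_boot all_order all_algebra.
From mathcomp Require Import all_classical all_reals all_analysis.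
Set Implicit Arguments.
Unset Strict Implicit.
Unset Printing Implicit Defensive.
Import Order.TTheory GRing.Theory Num.Theory.
Local Open Scope classical_set_scope.
Local Open Scope ring_scope.

Section Defs.
Variable R : realType.
Local Notation mu := (@lebesgue_measure R).

Definition Gamma (s : R) : R :=
  fine (\int[mu]_(t in `]0%R, +oo[) ((t `^ (s - 1)) * expR (- t))%:E)%E.

(* Lebesgue integral over R^n (points = n.-tuples), as iterated integrals
   (which, by Tonelli, is the n-dimensional Lebesgue integral for
   non-negative measurable integrands). *)
Fixpoint iint (n : nat) : (n.-tuple R -> \bar R) -> \bar R :=
  match n with
  | 0 => fun F => F [tuple]
  | n'.+1 => fun F => (\int[mu]_x iint (fun t : n'.-tuple R => F (cons_tuple x t)))%E
  end.

Definition lebn (n : nat) (A : set (n.-tuple R)) : \bar R :=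
  iint (fun t => (\1_A t : R)%:E).

Definition Kober_pre (k : nat) (zeta alpha : 'I_k -> R) (u : k.-tuple R) : R :=
  \prod_(j < k) (tnth u j `^ zeta j / Gamma (alpha j)).

Definition Kober_integrand (k : nat) (zeta alpha : 'I_k -> R)
    (f : k.-tuple R -> R) (u v : k.-tuple R) : R :=
  if `[< forall j, tnth u j < tnth v j >] then
    (\prod_(j < k) ((tnth v j - tnth u j) `^ (alpha j - 1) *
                     tnth v j `^ (- zeta j - alpha j))) * f v
  else 0.

Definition Kober (k : nat) (zeta alpha : 'I_k -> R) (f : k.-tuple R -> R)
    (u : k.-tuple R) : \bar R :=
  ((Kober_pre zeta alpha u)%:E *
   iint (fun v : k.-tuple R => (Kober_integrand zeta alpha f u v)%:E))%E.

(* gamma_j = alpha_{j+1}+...+alpha_k + beta_j+...+beta_k + (k-j)  (1-based);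
   here j : 'I_k is 0-based, so k - j becomes k - 1 - j. *)
Definition gam (k : nat) (alpha beta : 'I_k -> R) (j : 'I_k) : R :=
  \sum_(i < k | (j < i)%N) alpha i + \sum_(i < k | (j <= i)%N) beta i + (k - j.+1)%N%:R.

Definition psum (k : nat) (x : k.-tuple R) (j : 'I_k) : R :=
  \sum_(i < k | (i <= j)%N) tnth x i.

Definition f1dens (k : nat) (alpha beta : 'I_k -> R) (C1 : R)
    (x : k.-tuple R) : R :=
  if `[< forall j, 0 < tnth x j /\ 0 < psum x j < 1 >] then
    C1 * \prod_(j < k)
      (tnth x j `^ alpha j *
       (1 - psum x j) `^ (if j.+1 == k then beta j - 1 else beta j))
  else 0.

Definition utrans (k : nat) (x v : k.-tuple R) : k.-tuple R :=
  [tuple tnth v j * tnth x j / (1 - \sum_(i < k | (i < j)%N) tnth x i) | j < k].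

End Defs.

(* Main.v *)
Require Import Defs.
From HB Require Import structures.
From mathcomp Require Import all_boot all_order all_algebra.
From mathcomp Require Import all_classical all_reals all_analysis.
From mathcomp Require Import measurable_realfun ring lra.
Import Order.TTheory GRing.Theory Num.Theory.
Local Open Scope classical_set_scope.
Local Open Scope ring_scope.

(* For fixed positive v, the substitution u_j = v_j x_j / (1 - x_1 - ... - x_{j-1})
   can be made one coordinate at a time.  Freezing x_1 leaves a density of the
   same shape on a simplex of size 1 - x_1, so by induction on the number of
   variables only linear substitutions on the line are needed; the powers of
   1 - x_1 released by the remaining variables add up to the exponent
   gamma_1 - 1.  The x-density thus becomes the product of the kernels
   (u_j/v_j)^alpha_j (1 - u_j/v_j)^(gamma_j - 1) / v_j on 0 < u_j < v_j, and
   integrating against f (Tonelli) gives a density of u which is, up to a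
   constant, the Kober integral.  The same substitution with v = 1 evaluates
   C_1 as a product of Beta integrals, and two densities of the same law agree
   almost everywhere. *)

Set Implicit Arguments.
Unset Strict Implicit.

(** * Lebesgue measure on tuples *)

Section pushforward_sigma_finite.
Context d d' (X : measurableType d) (Y : measurableType d') (R : realType).
Variables (m : {measure set X -> \bar R}) (f : X -> Y) (g : Y -> X).
Hypothesis sigma_finite_m : sigma_finite setT m.
Hypotheses (mf : measurable_fun setT f) (mg : measurable_fun setT g).
Hypothesis fK : cancel f g.

Definition image_measure : set Y -> \bar R := pushforward m f.

Let image_measure0 : image_measure set0 = 0%E.
Proof. by rewrite /image_measure /pushforward preimage_set0 measure0. Qed.

Let image_measure_ge0 A : (0 <= image_measure A)%E.
Proof. exact: measure_ge0. Qed.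

Let image_measure_sigma_additive : semi_sigma_additive image_measure.
Proof. exact: measure_semi_sigma_additive. Qed.

HB.instance Definition _ := isMeasure.Build _ _ _ image_measure
  image_measure0 image_measure_ge0 image_measure_sigma_additive.

Let image_measure_sigma_finite : sigma_finite setT image_measure.
Proof.
have /sigma_finiteP[F [TF ndF Foo]] := sigma_finite_m.
(* The preimages cover all of [Y] because [g] is total, and pulling them back along [f] gives [F n]
   again since [g] is a left inverse. *)
exists (fun n => g @^-1` F n).
  by rewrite -preimage_bigcup -TF preimage_setT.
move=> n; have [mFn Fnoo] := Foo n; split.
  by rewrite -[X in measurable X]setTI; exact: mg.
rewrite /image_measure /pushforward.
by rewrite (_ : _ @^-1` _ = F n)//; apply/seteqP; split => x /=; rewrite fK.
Qed.

HB.instance Definition _ := @Measure_isSigmaFinite.Build _ _ _ image_measure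
  image_measure_sigma_finite.

Lemma sigma_finite_pushforward :
  exists m' : {sigma_finite_measure set Y -> \bar R},
    forall F : Y -> \bar R, measurable_fun [set: Y] F -> (forall y, 0 <= F y)%E ->
      (\int[m']_y F y = \int[m]_x F (f x))%E.
Proof.
exists image_measure => F mF F0.
have := @ge0_integral_pushforward _ _ _ _ _ _ mf m setT F measurableT mF.
by rewrite preimage_setT => <-.
Qed.
End pushforward_sigma_finite.

Section iterated_integral.
Context {R : realType}.
Local Notation mu := (@lebesgue_measure R).
Local Open Scope ereal_scope.

(** Lebesgue measure and its products live on [measurableTypeR R], tuples on [R]; the two carry the
    same sigma-algebra, and these identities transport measurability between them. *)
Lemma measurable_idTR : measurable_fun setT (idfun : measurableTypeR R -> R).
Proof. by move=> _ Y mY; rewrite setTI. Qed.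

Lemma measurable_idRT : measurable_fun setT (idfun : R -> measurableTypeR R).
Proof. by move=> _ Y mY; rewrite setTI. Qed.

Lemma measurable_cons_pair n :
  measurable_fun setT (fun p : measurableTypeR R * n.-tuple R =>
    cons_tuple (p.1 : R) p.2).
Proof.
apply: measurable_cons; last exact: measurable_snd.
exact: (measurableT_comp measurable_idTR measurable_fst).
Qed.

(** Realizing [iint] by one sigma-finite measure gives access to linearity, Tonelli and uniqueness
    of densities. In the induction step the measure is the image under consing of the product of
    Lebesgue measure and the measure in dimension [n]; Tonelli unfolds it into the iterated
    integral. *)
Lemma iint_measure n : exists m : {sigma_finite_measure set (n.-tuple R) -> \bar R},
  forall F : n.-tuple R -> \bar R, measurable_fun setT F ->
    (forall t, 0 <= F t) -> iint F = \int[m]_t F t.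
Proof.
elim: n => [|n [m IH]].
  exists (dirac ([tuple] : 0.-tuple R)) => F mF F0 /=.
  by rewrite integral_dirac// diracT mul1e.
pose c (p : measurableTypeR R * n.-tuple R) : n.+1.-tuple R := cons_tuple p.1 p.2.
pose g (t : n.+1.-tuple R) : measurableTypeR R * n.-tuple R :=
  (thead t, [tuple of behead t]).
have mc : measurable_fun setT c by exact: measurable_cons_pair.
have mg : measurable_fun setT g.
  apply/measurable_fun_pairP; split; last exact: measurable_behead.
  exact: (measurableT_comp measurable_idRT (measurable_tnth ord0)).
have cK : cancel c g by move=> [x t]; congr pair; apply/val_inj.
(* The canonical sigma-finite structure found on a product measure is the one
   for subprobabilities, hence the direct use of the library's fact. *)
have [M HM] := sigma_finite_pushforward
  (lebesgue_integral_fubini.product_measure_sigma_finite_subproof mu m) mc mg cK.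
exists M => F mF F0.
rewrite HM// fubini_tonelli1//; last exact: (measurableT_comp mF mc).
apply: eq_integral => x _; apply: (IH (fun t => F (cons_tuple x t))) => //.
apply: (measurableT_comp mF).
by apply: measurable_cons => //; exact: measurable_id.
Qed.
End iterated_integral.

Definition lebtuple {R : realType} n : {sigma_finite_measure set (n.-tuple R) -> \bar R} :=
  sval (cid (@iint_measure R n)).

Lemma iintE {R : realType} n (F : n.-tuple R -> \bar R) :
  measurable_fun setT F -> (forall t, 0 <= F t)%E ->
  iint F = (\int[lebtuple n]_t F t)%E.
Proof. exact: (svalP (cid (@iint_measure R n))). Qed.

(** * Affine substitutions and densities *)

Section lebesgue_affine.
Context {R : realType}.
Local Notation mu := (@lebesgue_measure R).
Local Open Scope ereal_scope.

Lemma measurable_toTR (f : R -> R) : measurable_fun setT f ->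
  measurable_fun setT (f : measurableTypeR R -> measurableTypeR R).
Proof. by move=> mf _ Y mY; exact: mf. Qed.

(** The image of Lebesgue measure under [x |-> c * x], multiplied by [c], has the right value on
    half-open intervals, hence is Lebesgue measure. *)
Lemma ge0_integral_scale (c : R) (F : R -> \bar R) : (0 < c)%R ->
  measurable_fun setT F -> (forall x, 0 <= F x) ->
  \int[mu]_x F x = c%:E * \int[mu]_x F (c * x)%R.
Proof.
move=> c0 mF F0; have c0' := ltW c0.
have mc : measurable_fun setT (fun x : measurableTypeR R => (c * x)%R : measurableTypeR R).
  by apply: measurable_toTR; apply: measurable_funM.
pose nu := mscale (NngNum c0') (pushforward mu
  (fun x : measurableTypeR R => (c * x)%R : measurableTypeR R)).
transitivity (\int[nu mc]_x F x).
  apply: eq_measure_integral => A mA _; apply: lebesgue_measure_unique => //.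
  move=> _ [[a b]] /= _ <-.
  rewrite /nu /mscale /= /pushforward.
  rewrite (_ : _ @^-1` _ = `](a / c)%R, (b / c)%R]%classic); last first.
    apply/seteqP; split => x /=; rewrite !in_itv/= ltr_pdivrMr// ler_pdivlMr//;
    by rewrite mulrC.
  rewrite !lebesgue_measure_itv/= !lte_fin ltr_pM2r ?invr_gt0//.
  case: ifPn => _; last by rewrite mule0.
  by rewrite -!EFinD -EFinM -mulrBl mulrCA divff ?mulr1// gt_eqF.
rewrite ge0_integral_mscale//= ge0_integral_pushforward//.
Qed.

(** Again by uniqueness: a translation preserves the length of half-open intervals. *)
Lemma ge0_integral_shift (c : R) (F : R -> \bar R) :
  measurable_fun setT F -> (forall x, 0 <= F x) ->
  \int[mu]_x F x = \int[mu]_x F (x + c)%R.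
Proof.
move=> mF F0.
have mc : measurable_fun setT (fun x : measurableTypeR R => (x + c)%R : measurableTypeR R).
  by apply: measurable_toTR; apply: measurable_funD.
pose nu := pushforward mu
  (fun x : measurableTypeR R => (x + c)%R : measurableTypeR R).
transitivity (\int[nu]_x F x).
  apply: eq_measure_integral => A mA _; apply: lebesgue_measure_unique => //.
  move=> _ [[a b]] /= _ <-.
  rewrite /nu /pushforward.
  rewrite (_ : _ @^-1` _ = `](a - c)%R, (b - c)%R]%classic); last first.
    by apply/seteqP; split => x /=; rewrite !in_itv/= ltrBlDr lerBrDr.
  rewrite !lebesgue_measure_itv/= !lte_fin ltrD2r.
  case: ifPn => // _.
  by rewrite -!EFinD opprB addrA subrK.
by rewrite ge0_integral_pushforward.
Qed.
End lebesgue_affine.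

Section density.
Local Open Scope ereal_scope.
Context d (T : measurableType d) {R : realType}.
Variables (m : {sigma_finite_measure set T -> \bar R}) (nu : {finite_measure set T -> \bar R}).
Variable f : T -> R.
Hypotheses (mf : measurable_fun setT f) (f0 : forall x, (0 <= f x)%R).
Hypothesis nuE : forall A, measurable A -> nu A = \int[m]_(x in A) (f x)%:E.

(** [nu] is dominated by [m], and its Radon-Nikodym derivative has the same integral as [f] over
    every measurable set, so the two agree almost everywhere; the change of variables for the
    derivative then applies to [f]. *)
Lemma ge0_integral_density (phi : T -> \bar R) :
  measurable_fun setT phi -> (forall x, 0 <= phi x) ->
  \int[nu]_x phi x = \int[m]_x (phi x * (f x)%:E).
Proof.
move=> mphi phi0.
have num : nu `<< m.
  apply/null_content_dominatesP => A mA mA0.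
  by rewrite nuE// null_set_integral//; exact/measurable_EFinP/measurable_funTS.
have mRN := measurable_int _ (Radon_Nikodym_SigmaFinite.f_integrable num).
rewrite -(Radon_Nikodym_SigmaFinite.change_of_variables num)//.
apply: ge0_ae_eq_integral => //.
- exact: emeasurable_funM.
- by apply: emeasurable_funM => //; exact/measurable_EFinP.
- by move=> x _; rewrite mule_ge0// Radon_Nikodym_SigmaFinite.f_ge0.
- by move=> x _; rewrite mule_ge0// lee_fin.
- apply: ae_eqe_mul2l; apply: integral_ae_eq => //.
  + exact: Radon_Nikodym_SigmaFinite.f_integrable.
  + exact/measurable_EFinP.
  + by move=> E _ mE; rewrite -Radon_Nikodym_SigmaFinite.f_integral// nuE.
Qed.
End density.

(** * Gamma and Beta integrals *)

Section gamma_beta.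
Import numFieldNormedType.Exports.
Context {R : realType}.
Local Notation mu := (@lebesgue_measure R).

(** The cutoff at 0 is part of the function, so that shifts and rescalings act on integrals over the
    whole line. *)
Definition gammaker (s t : R) : R := if 0 < t then t `^ (s - 1) * expR (- t) else 0.

Lemma gammaker_ge0 s t : 0 <= gammaker s t.
Proof. by rewrite /gammaker; case: ifP => // _; rewrite mulr_ge0 ?powR_ge0 ?expR_ge0. Qed.

Lemma measurable_gammaker s : measurable_fun setT (gammaker s).
Proof.
apply: measurable_fun_ifT => //; first exact: measurable_fun_ltr.
apply: measurable_funM; first exact: measurable_powR.
by apply: measurableT_comp => //; exact: measurable_funN.
Qed.

Definition gammaint (s : R) : \bar R := (\int[mu]_t (gammaker s t)%:E)%E.

Lemma gammaint_ge0 s : (0 <= gammaint s)%E.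
Proof. by apply: integral_ge0 => t _; rewrite lee_fin gammaker_ge0. Qed.

Lemma Gamma_gammaint s : Gamma s = fine (gammaint s).
Proof.
rewrite /Gamma /gammaint [in LHS]integral_mkcond; congr fine.
apply: eq_integral => t _; rewrite patchE mem_setE in_itv/= andbT /gammaker.
by case: ifP.
Qed.

Lemma integral01_powR_lty (s : R) : 0 < s ->
  (\int[mu]_(t in `]0%R, 1%R]) (t `^ (s - 1))%:E < +oo)%E.
Proof.
move=> s0.
have mp D : measurable_fun D (fun t : R => (t `^ (s - 1))%:E).
  by apply/measurable_EFinP/measurable_funTS; exact: measurable_powR.
(* The index [n.+2] keeps the left endpoint strictly below 1, as the fundamental theorem of calculus
   requires. *)
pose F (n : nat) : set R := `[n.+2%:R^-1, 1]%classic.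
have F1 n : n.+2%:R^-1 < 1 :> R by rewrite invf_lt1// ltr1n.
have n0 n : 0 < n.+2%:R^-1 :> R by rewrite invr_gt0.
have -> : `]0%R, 1%R]%classic = \bigcup_i F i.
  apply/seteqP; split => x /=; rewrite in_itv/=.
    move=> /andP[x0 x1]; have [n /ltW nx] : exists n, n.+2%:R^-1 < x.
      have [n _ /= Hn] := near_infty_natSinv_lt (PosNum x0).
      exists n; apply: le_lt_trans (Hn n (leqnn n)).
      by rewrite lef_pV2 ?posrE// ler_nat.
    by exists n => //=; rewrite /F/= in_itv/= nx.
  move=> [n _]; rewrite /F/= in_itv/= => /andP[nx ->].
  by rewrite andbT (lt_le_trans _ nx).
have cvgF : (\int[mu]_(t in F n) (t `^ (s - 1))%:E @[n --> \oo] -->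
    \int[mu]_(t in \bigcup_i F i) (t `^ (s - 1))%:E)%E.
  apply: ge0_nondecreasing_set_cvg_integral => //.
  - move=> i j ij; apply/subsetPset => x; rewrite /F/= !in_itv/= => /andP[ix ->].
    by rewrite andbT (le_trans _ ix)// lef_pV2 ?posrE// ler_nat.
  - by move=> i; exact: (measurable_itv `[i.+2%:R^-1, 1]).
  - by move=> i mFi Y mY; exact: (mp (F i) mFi Y mY).
  - by move=> i x _; rewrite lee_fin powR_ge0.
apply: (@le_lt_trans _ _ (s^-1)%:E); last exact: ltry.
have HI n : (\int[mu]_(x in F n) (x `^ (s - 1))%:E <= (s^-1)%:E)%E.
  have ctsp (r x : R) : 0 < x -> {for x, continuous (fun t : R => t `^ r)}.
    move=> x0; apply/differentiable_continuous/derivable1_diffP.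
    by apply: derivable_powR; rewrite in_itv/= x0.
  rewrite (@continuous_FTC2 _ _ (fun t => s^-1 * t `^ s))//.
  - rewrite powR1 mulr1 -EFinB lee_fin lerBlDr lerDl.
    by rewrite mulr_ge0 ?powR_ge0// invr_ge0 ltW.
  - apply: continuous_in_subspaceT => x; rewrite inE/= in_itv/= => /andP[nx _].
    by apply: ctsp; exact: lt_le_trans nx.
  - split.
    + move=> x; rewrite in_itv/= => /andP[nx _].
      apply: derivableM => //; apply: derivable_powR.
      by rewrite in_itv/= andbT (lt_trans _ nx).
    + apply: cvg_at_right_filter; apply: cvgM; first exact: cvg_cst.
      exact: ctsp.
    + apply: cvg_at_left_filter; apply: cvgM; first exact: cvg_cst.
      exact: ctsp.
  - move=> x; rewrite in_itv/= => /andP[nx _].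
    have x0 : 0 < x by rewrite (lt_trans _ nx).
    rewrite derive1E deriveM//; last first.
      by apply: derivable_powR; rewrite in_itv/= andbT.
    rewrite derive_cst scaler0 addr0.
    have [_ ->] := is_derive1_powR s x0.
    by rewrite /GRing.scale/= mulrA mulVf ?mul1r// gt_eqF.
rewrite -(cvg_lim _ cvgF)//; apply: lime_le; last exact: nearW.
by apply/cvg_ex; eexists; exact: cvgF.
Qed.

(** Half of the exponential decay absorbs the power of [t], which leaves an integrable tail. *)
Lemma powR_expRN_le (s t : R) : 1 <= t ->
  t `^ (s - 1) * expR (- t) <=
  expR (`|s - 1| * ln (2 * `|s - 1| + 1)) * expR (- 2^-1 * t).
Proof.
move=> t1; have t0 : 0 < t by exact: lt_le_trans t1.
rewrite /powR gt_eqF// -!expRD ler_expR.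
set c := `|s - 1|; have c0 : 0 <= c := normr_ge0 _.
set K := 2 * c + 1; have K0 : 0 < K by rewrite ltr_wpDl// mulr_ge0.
have h1 : (s - 1) * ln t <= c * ln t.
  by apply: ler_wpM2r; [exact: ln_ge0|exact: ler_norm].
(* Split [t] as [t / K * K] and bound the logarithm of [t / K] by [t / K]; the choice
   [K = 2 * c + 1] makes the linear term, once multiplied by [c], at most [t / 2]. *)
have h2 : ln t <= ln K + t / K.
  rewrite -{1}(divfK (lt0r_neq0 K0) t) lnM ?posrE ?divr_gt0// addrC lerD2l.
  by apply/ltW/ln_sublinear; rewrite divr_gt0.
have h3 : c * (t / K) <= t / 2.
  rewrite mulrCA ler_pM2l// ler_pdivrMr// ler_pdivlMl// /K.
  by rewrite lerDl.
have h4 : c * ln t <= c * ln K + c * (t / K) by rewrite -mulrDr ler_wpM2l.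
by lra.
Qed.

(** The kernel is dominated by the bare power on []0, 1]] plus an exponential tail of rate one
    half. *)
Lemma gammaint_lty (s : R) : 0 < s -> (gammaint s < +oo)%E.
Proof.
move=> s0; set C := expR (`|s - 1| * ln (2 * `|s - 1| + 1)).
pose p1 (t : R) : R := if t \in `]0, 1] then t `^ (s - 1) else 0.
(* The factor 2 cancels the normalization of the exponential density of rate [2^-1]. *)
pose p2 (t : R) : R := 2 * C * exponential_pdf 2^-1 t.
have mp1 : measurable_fun setT p1.
  apply: measurable_fun_ifT => //.
  rewrite [X in measurable_fun _ X](_ : _ = fun t : R => (0 < t) && (t <= 1)); last first.
    by apply/funext => t; rewrite in_itv.
  by apply: measurable_and; [exact: measurable_fun_ltr|exact: measurable_fun_ler].
have mp2 : measurable_fun setT p2.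
  by apply: measurable_funM => //; exact: measurable_exponential_pdf.
have p10 t : 0 <= p1 t by rewrite /p1; case: ifP => // _; rewrite powR_ge0.
have p20 t : 0 <= p2 t.
  by rewrite mulr_ge0 ?exponential_pdf_ge0// mulr_ge0// expR_ge0.
apply: (@le_lt_trans _ _ (\int[mu]_t ((p1 t)%:E + (p2 t)%:E))%E).
  apply: ge0_le_integral => //.
  - by move=> t _; rewrite lee_fin gammaker_ge0.
  - apply/measurable_EFinP; exact: measurable_gammaker.
  - by apply: emeasurable_funD; apply/measurable_EFinP.
  - move=> t _; rewrite -EFinD lee_fin /gammaker; case: ifP => t0; last first.
      by rewrite addr_ge0.
    have [t1|t1] := leP t 1.
      rewrite /p1 in_itv/= t0 t1 -[leLHS]addr0 lerD//.
      by rewrite ler_piMr ?powR_ge0// -expR0 ler_expR oppr_le0 ltW.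
    rewrite -[leLHS]add0r lerD//.
    apply: (le_trans (powR_expRN_le s (ltW t1))).
    rewrite /p2 exponential_pdfE ?(ltW t0)// -/C.
    by rewrite [leRHS](_ : _ = C * expR (- 2^-1 * t))//; field.
rewrite ge0_integralD//; last 4 first.
- by move=> t _; rewrite lee_fin.
- exact/measurable_EFinP.
- by move=> t _; rewrite lee_fin.
- exact/measurable_EFinP.
apply: lte_add_pinfty.
  rewrite (le_lt_trans _ (integral01_powR_lty s0))// [leRHS]integral_mkcond.
  rewrite le_eqVlt; apply/orP; left; apply/eqP; apply: eq_integral => t _.
  by rewrite patchE mem_setE /p1; case: ifP.
rewrite (_ : (fun t => _) = (fun t => (2 * C)%:E * (exponential_pdf 2^-1 t)%:E)%E)//.
rewrite ge0_integralZl_EFin//.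
- by rewrite integral_exponential_pdf// mule1 ltry.
- by move=> t _; rewrite lee_fin exponential_pdf_ge0.
- by apply/measurable_EFinP; exact: measurable_exponential_pdf.
- by rewrite mulr_ge0// expR_ge0.
Qed.

(** A zero integral would make the kernel vanish almost everywhere, whereas it is positive on []0,
    1]], a set of measure 1. *)
Lemma gammaint_gt0 (s : R) : (0 < gammaint s)%E.
Proof.
rewrite lt_neqAle gammaint_ge0 andbT; apply/eqP => g0.
have mg : measurable_fun setT (fun t : measurableTypeR R => (gammaker s t)%:E).
  apply/measurable_EFinP; exact: measurable_gammaker.
have : (\int[mu]_t `|(gammaker s t)%:E| = 0)%E.
  by rewrite g0; apply: eq_integral => t _; rewrite gee0_abs// lee_fin gammaker_ge0.
move=> /(ae_eq_integral_abs mu measurableT mg) [N [mN N0 sN]].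
have : (mu `]0%R, 1%R] <= mu N)%E.
  apply: le_measure; rewrite ?inE//.
  apply: subset_trans sN => t /=; rewrite in_itv/= => /andP[t0 _] /(_ I)[].
  by rewrite /gammaker t0 => /eqP; rewrite mulf_eq0 !gt_eqF ?expR_gt0 ?powR_gt0.
by rewrite N0 lebesgue_measure_itv/= lte01 oppr0 adde0 leNgt lte01.
Qed.

Lemma Gamma_gt0 (s : R) : 0 < s -> 0 < Gamma s.
Proof.
by move=> s0; rewrite Gamma_gammaint fine_gt0// gammaint_gt0 gammaint_lty.
Qed.

Lemma EFin_Gamma (s : R) : 0 < s -> (Gamma s)%:E = gammaint s.
Proof.
by move=> s0; rewrite Gamma_gammaint fineK// ge0_fin_numE ?gammaint_ge0 ?gammaint_lty.
Qed.

(* Unnormalised density at [u] of [v * y], where [y] is a type-1 beta variable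
   with density proportional to [y ^ a * (1 - y) ^ c]. *)
Definition betaker (a c v u : R) : R :=
  if (0 < u) && (u < v) then (u / v) `^ a * (1 - u / v) `^ c / v else 0.

Lemma betaker_ge0 a c v u : 0 <= betaker a c v u.
Proof.
rewrite /betaker; case: ifP => // /andP[u0 uv].
by rewrite !mulr_ge0 ?powR_ge0// invr_ge0 ltW// (lt_trans u0).
Qed.

(** Inversion is reduced to the power of exponent -1, extended to negative arguments by oddness; at
    0 both conventions give 0. *)
Lemma measurable_invr : measurable_fun setT (fun x : R => x^-1).
Proof.
rewrite (_ : (fun x => _) = fun x : R =>
    if 0 <= x then x `^ (-1) else - (- x) `^ (-1)); last first.
  apply/funext => x; case: ifPn => [x0|]; first by rewrite powR_inv1.
  by rewrite -ltNge => x0; rewrite powR_inv1 ?oppr_ge0 ?ltW// invrN opprK.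
apply: measurable_fun_ifT => //; first exact: measurable_fun_ler.
apply: measurable_funN; apply: (measurableT_comp (measurable_powR _)).
exact: measurable_funN.
Qed.

Lemma measurable_funV d (T : measurableType d) (f : T -> R) :
  measurable_fun setT f -> measurable_fun setT (fun x => (f x)^-1).
Proof. exact: (measurableT_comp measurable_invr). Qed.

Lemma measurable_betaker d (T : measurableType d) a c (v u : T -> R) :
  measurable_fun setT v -> measurable_fun setT u ->
  measurable_fun setT (fun t => betaker a c (v t) (u t)).
Proof.
move=> mv mu_; apply: measurable_fun_ifT => //.
  by apply: measurable_and; exact: measurable_fun_ltr.
have mV : measurable_fun setT (fun t => (v t)^-1).
  exact: measurable_funV.
have muv : measurable_fun setT (fun t => u t / v t) by exact: measurable_funM.
apply: measurable_funM => //; apply: measurable_funM.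
  exact: (measurableT_comp (measurable_powR a) muv).
apply: (measurableT_comp (measurable_powR c)).
exact: measurable_funB.
Qed.

(* The two factors are convolved: writing the second variable as [y - x] and
   swapping the integrals, the inner integral rescales to the beta integral. *)
Lemma gammaint_betaker (a c : R) :
  (gammaint (a + 1) * gammaint (c + 1) =
   gammaint (a + c + 2) * \int[mu]_u (betaker a c 1 u)%:E)%E.
Proof.
have mgE s : measurable_fun setT (fun t : R => (gammaker s t)%:E).
  by apply/measurable_EFinP; exact: measurable_gammaker.
have gE0 s t : (0 <= (gammaker s t)%:E)%E by rewrite lee_fin gammaker_ge0.
have I0 s : (0 <= \int[mu]_t (gammaker s t)%:E)%E by exact: integral_ge0.
have mgB s : measurable_fun setT (fun t : measurableTypeR R * measurableTypeR R =>
    (gammaker s (t.2 - t.1))%:E).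
  apply/measurable_EFinP; apply: (measurableT_comp (measurable_gammaker s)).
  apply: measurable_funB.
    by move=> _ Y mY; exact: measurable_snd.
  by move=> _ Y mY; exact: measurable_fst.
rewrite /gammaint -ge0_integralZr//; last exact: mgE.
transitivity (\int[mu]_x \int[mu]_y
    ((gammaker (a + 1) x)%:E * (gammaker (c + 1) (y - x))%:E))%E.
  apply: eq_integral => x _.
  rewrite (ge0_integral_shift (- x)) ?ge0_integralZl//.
  exact: (measurableT_comp (mgB (c + 1)) (pair1_measurable x)).
rewrite (fubini_tonelli (fun p : measurableTypeR R * measurableTypeR R =>
  (gammaker (a + 1) p.1)%:E * (gammaker (c + 1) (p.2 - p.1))%:E)%E); last 2 first.
- apply: emeasurable_funM => //.
  by move=> mT Y mY; exact: (measurableT_comp (mgE (a + 1)) measurable_fst).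
- by move=> p; exact: mule_ge0.
rewrite -ge0_integralZr//; [|exact: mgE|]; last first.
  by apply: integral_ge0 => u _; rewrite lee_fin betaker_ge0.
apply: eq_integral => y _ /=.
(* For [y <= 0] both sides vanish: [0 < x] and [0 < y - x] cannot hold together. *)
have [y0|y0] := ltP 0 y; last first.
  rewrite integral0_eq; last first.
    move=> x _; rewrite -EFinM /gammaker; case: ifPn => [x0|]; last by rewrite mul0r.
    by rewrite ifF ?mulr0//; apply/negbTE; rewrite -leNgt; lra.
  by rewrite /gammaker ifF ?mul0e//; apply/negbTE; rewrite -leNgt.
have mg12 : measurable_fun setT (fun x : R =>
    ((gammaker (a + 1) x)%:E * (gammaker (c + 1) (y - x))%:E)%E).
  apply: emeasurable_funM; first exact: mgE.
  apply/measurable_EFinP; apply: (measurableT_comp (measurable_gammaker _)).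
  exact: measurable_funB.
(* The substitution of [y * x] for [x] carries the interval from 0 to [y] onto the unit interval. *)
rewrite (ge0_integral_scale y0 mg12); last by move=> x; exact: mule_ge0.
rewrite -ge0_integralZl//; last 3 first.
- have my : measurable_fun setT (fun x : R => y * x) by exact: measurable_funM.
  exact: (measurableT_comp mg12 my).
- by move=> x _; exact: mule_ge0.
- by rewrite lee_fin ltW.
rewrite -ge0_integralZl//; last 2 first.
- by apply/measurable_EFinP; exact: measurable_betaker.
- by move=> x _; rewrite lee_fin betaker_ge0.
apply: eq_integral => x _; rewrite -!EFinM; congr EFin.
rewrite /gammaker /betaker y0 pmulr_rgt0//.
have -> : (0 < y - y * x) = (x < 1) by rewrite subr_gt0 gtr_pMr.
case: (ltP 0 x) => x0 /=; last by rewrite mul0r !mulr0.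
case: (ltP x 1) => x1; last by rewrite !mulr0.
have x1' : 0 <= 1 - x by rewrite subr_ge0 ltW.
rewrite !addrK !divr1 (_ : y - y * x = y * (1 - x)); last by rewrite mulrBr mulr1.
rewrite !powRM ?(ltW y0) ?(ltW x0)//.
have -> : expR (- y) = expR (- (y * x)) * expR (- (y * (1 - x))).
  by rewrite -expRD; congr expR; ring.
(* The lone factor [y] is the Jacobian of the rescaling. *)
have -> : y `^ (a + c + 2 - 1) = y `^ a * y `^ c * y.
  have yn0 (r : R) : (r == 0) ==> (y != 0) by rewrite (gt_eqF y0) implybT.
  rewrite (_ : a + c + 2 - 1 = a + c + 1); last by ring.
  by rewrite !powRD// powRr1// ltW.
ring.
Qed.
End gamma_beta.

(** * The stick-breaking substitution *)

Section iint_lemmas.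
Context {R : realType}.
Local Open Scope ereal_scope.

Lemma eq_iint n (F G : n.-tuple R -> \bar R) : F =1 G -> iint F = iint G.
Proof. by move=> /funext ->. Qed.

Lemma iint_ge0 n (F : n.-tuple R -> \bar R) : (forall t, 0 <= F t) -> 0 <= iint F.
Proof.
elim: n F => [|n IH] F F0 /=; first exact: F0.
by apply: integral_ge0 => x _; apply: IH.
Qed.

Lemma iintZl n (k : R) (F : n.-tuple R -> \bar R) : (0 <= k)%R ->
  measurable_fun setT F -> (forall t, 0 <= F t) ->
  iint (fun t => k%:E * F t) = k%:E * iint F.
Proof.
move=> k0 mF F0; rewrite iintE; last 2 first.
- exact: measurable_funeM.
- by move=> t; rewrite mule_ge0.
by rewrite ge0_integralZl_EFin// -iintE.
Qed.

Lemma measurable_cons_tuple n (x : R) :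
  measurable_fun setT (fun t : n.-tuple R => cons_tuple x t).
Proof. by apply: measurable_cons => //; exact: measurable_id. Qed.

(** Tonelli's measurability of partial integrals, read through [lebtuple]. *)
Lemma measurable_iint_cons n (F : n.+1.-tuple R -> \bar R) :
  measurable_fun setT F -> (forall t, 0 <= F t) ->
  measurable_fun setT (fun x : R => iint (fun t => F (cons_tuple x t))).
Proof.
move=> mF F0.
have := @measurable_fun_fubini_tonelli_F _ _ (measurableTypeR R) _ _ (lebtuple n)
  (fun p : measurableTypeR R * n.-tuple R => F (cons_tuple p.1 p.2)).
move=> /(_ (measurableT_comp mF (@measurable_cons_pair R n)) (fun=> F0 _)) mI.
rewrite (_ : (fun x => _) =
  fubini_F (lebtuple n) (fun p : measurableTypeR R * n.-tuple R =>
    F (cons_tuple p.1 p.2))); first by move=> _ Y mY; exact: mI.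
apply/funext => x; rewrite iintE//.
exact: (measurableT_comp mF (measurable_cons_tuple x)).
Qed.

Lemma iint_prod n (w : 'I_n -> R -> R) : (forall j x, (0 <= w j x)%R) ->
  (forall j, measurable_fun setT (w j)) ->
  iint (fun t => (\prod_(j < n) w j (tnth t j))%:E) =
  \prod_(j < n) \int[lebesgue_measure]_x (w j x)%:E.
Proof.
elim: n w => [|n IH] w w0 mw /=; first by rewrite !big_ord0.
have mprod : measurable_fun setT (fun t : n.-tuple R =>
    (\prod_(j < n) w (lift ord0 j) (tnth t j))%:E).
  apply/measurable_EFinP; apply: measurable_prod => j _.
  exact: (measurableT_comp (mw _) (measurable_tnth j)).
rewrite big_ord_recl -IH// -ge0_integralZr//.
- apply: eq_integral => x _.
  rewrite -[RHS]iintZl//; last by move=> t; rewrite lee_fin prodr_ge0.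
  apply: eq_iint => t; rewrite big_ord_recl EFinM; congr (_ * _%:E).
  by apply: eq_bigr => j _; rewrite tnthS.
- have /measurable_EFinP mw0 := mw ord0.
  by move=> _ Y mY; exact: mw0.
- by move=> x _; rewrite lee_fin.
- by apply: iint_ge0 => t; rewrite lee_fin prodr_ge0.
Qed.
End iint_lemmas.

Section stick_breaking.
Context {R : realType}.
Implicit Types (n : nat) (s : R).

(* [simplexker 1] is [f1dens] without its constant; the size [s] of the simplex
   is what changes when the first coordinate is frozen. *)
Definition simplexker n s (a b : 'I_n -> R) (t : n.-tuple R) : R :=
  if `[< forall j, 0 < tnth t j /\ psum t j < s >] then
    \prod_(j < n) (tnth t j `^ a j * (s - psum t j) `^ b j) else 0.

(* [stick 1] is [utrans]. *)
Definition stick n s (t v : n.-tuple R) : n.-tuple R :=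
  [tuple tnth v j * tnth t j / (s - \sum_(i < n | (i < j)%N) tnth t i) | j < n].

Definition betaprod n (a c : 'I_n -> R) (v u : n.-tuple R) : R :=
  \prod_(j < n) betaker (a j) (c j) (tnth v j) (tnth u j).

Lemma simplexker_ge0 n s a b (t : n.-tuple R) : 0 <= simplexker s a b t.
Proof.
rewrite /simplexker; case: asboolP => // _.
by apply: prodr_ge0 => j _; rewrite mulr_ge0 ?powR_ge0.
Qed.

Lemma betaprod_ge0 n a c (v u : n.-tuple R) : 0 <= betaprod a c v u.
Proof. by apply: prodr_ge0 => j _; exact: betaker_ge0. Qed.

(** Over a finite index type the quantifier is a finite conjunction along the enumeration. *)
Lemma measurable_asbool_forall d (T : measurableType d) (I : finType) (p : I -> T -> bool) :
  (forall i, measurable_fun setT (p i)) ->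
  measurable_fun setT (fun t => `[< forall i, p i t >]).
Proof.
move=> mp; rewrite (_ : (fun t => _) = fun t => all (p^~ t) (enum I)); last first.
  apply/funext => t; apply/asboolP/allP => [H i _//|H i].
  by apply: H; rewrite mem_enum.
elim: (enum I) => [|i e IH] //=.
exact: measurable_and.
Qed.

Lemma measurable_tnth_comp d (T : measurableType d) n (f : T -> n.-tuple R) j :
  measurable_fun setT f -> measurable_fun setT (fun x => tnth (f x) j).
Proof. by move=> mf; exact: (measurableT_comp (measurable_tnth j) mf). Qed.

Lemma measurable_sum_tnth n (P : pred 'I_n) :
  measurable_fun setT (fun t : n.-tuple R => \sum_(i < n | P i) tnth t i).
Proof.
rewrite (_ : (fun t => _) = fun t => \sum_(i <- [seq i <- index_enum 'I_n | P i]) tnth t i).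
  by apply: measurable_sum => i; exact: measurable_tnth.
by apply/funext => t; rewrite big_filter.
Qed.

Lemma measurable_simplexker n s a b :
  measurable_fun setT (fun t : n.-tuple R => simplexker s a b t).
Proof.
have mps j : measurable_fun setT (fun t : n.-tuple R => psum t j).
  exact: measurable_sum_tnth.
apply: measurable_fun_ifT => //.
  rewrite (_ : (fun t => _) = fun t : n.-tuple R =>
    `[< forall j, (0 < tnth t j) && (psum t j < s) >]); last first.
    by apply/funext => t; apply: asbool_equiv_eq; split => H j; apply/andP; exact: H.
  apply: measurable_asbool_forall => j; apply: measurable_and.
    by apply: measurable_fun_ltr => //; exact: measurable_tnth.
  exact: measurable_fun_ltr.
apply: measurable_prod => j _; apply: measurable_funM.
  exact: (measurableT_comp (measurable_powR _) (measurable_tnth j)).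
apply: (measurableT_comp (measurable_powR _)).
exact: measurable_funB.
Qed.

Lemma measurable_stick d (T : measurableType d) n s (t v : T -> n.-tuple R) :
  measurable_fun setT t -> measurable_fun setT v ->
  measurable_fun setT (fun x => stick s (t x) (v x)).
Proof.
move=> mt mv; apply/measurable_fun_tnthP => j.
rewrite (_ : _ \o _ = fun x => tnth (v x) j * tnth (t x) j /
    (s - \sum_(i < n | (i < j)%N) tnth (t x) i)); last first.
  by apply/funext => x /=; rewrite tnth_mktuple.
apply: measurable_funM.
  by apply: measurable_funM; exact: measurable_tnth_comp.
apply: measurable_funV; apply: measurable_funB => //.
exact: (measurableT_comp (measurable_sum_tnth _) mt).
Qed.

Lemma measurable_betaprod d (T : measurableType d) n a c (v u : T -> n.-tuple R) :
  measurable_fun setT v -> measurable_fun setT u ->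
  measurable_fun setT (fun x => betaprod a c (v x) (u x)).
Proof.
move=> mv mu; apply: measurable_prod => j _.
by apply: measurable_betaker; exact: measurable_tnth_comp.
Qed.

Lemma sum_tnth_cons n (x : R) (t : n.-tuple R) (P : pred nat) :
  \sum_(i < n.+1 | P i) tnth (cons_tuple x t) i =
  (if P 0 then x else 0) + \sum_(i < n | P i.+1) tnth t i.
Proof.
rewrite big_mkcond big_ord_recl /=; congr (_ + _).
rewrite [RHS]big_mkcond; apply: eq_bigr => i _.
by rewrite [tnth (cons_tuple _ _) _]tnthS.
Qed.

Lemma psum_cons0 n (x : R) (t : n.-tuple R) : psum (cons_tuple x t) ord0 = x.
Proof.
by rewrite /psum (sum_tnth_cons _ _ (fun i => i <= 0)%N) /= big_pred0 ?addr0.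
Qed.

Lemma psum_consS n (x : R) (t : n.-tuple R) j :
  psum (cons_tuple x t) (lift ord0 j) = x + psum t j.
Proof. by rewrite /psum (sum_tnth_cons _ _ (fun i => i <= lift ord0 j)%N). Qed.

(** Every later partial sum contains [x], so the remaining coordinates see a simplex of size
    [s - x]. This is the recursion behind the induction on the number of variables. *)
Lemma simplexker_cons n s (a b : 'I_n.+1 -> R) x (t : n.-tuple R) :
  simplexker s a b (cons_tuple x t) =
  (if (0 < x) && (x < s) then x `^ a ord0 * (s - x) `^ b ord0 else 0) *
  simplexker (s - x) (a \o lift ord0) (b \o lift ord0) t.
Proof.
case: ifPn => [/andP[x0 xs]|xs]; last first.
  rewrite mul0r /simplexker; case: asboolP => // /(_ ord0); rewrite psum_cons0.
  by move=> [x0 x1]; rewrite x1 andbT in xs; rewrite x0 in xs.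
rewrite /simplexker; case: asboolP => H1; case: asboolP => H2.
- rewrite big_ord_recl psum_cons0; congr (_ * _); apply: eq_bigr => j _.
  by rewrite psum_consS tnthS opprD addrA.
- exfalso; apply: H2 => j; have := H1 (lift ord0 j).
  by rewrite psum_consS tnthS ltrBrDl.
- exfalso; apply: H1 => j; case: (unliftP ord0 j) => [i ->|->].
    by rewrite psum_consS tnthS -ltrBrDl; exact: H2.
  by rewrite psum_cons0.
- by rewrite mulr0.
Qed.

Lemma stick_cons n s x (t : n.-tuple R) (v : n.+1.-tuple R) :
  stick s (cons_tuple x t) v =
  cons_tuple (thead v * x / s) (stick (s - x) t [tuple of behead v]).
Proof.
apply: eq_from_tnth => j; rewrite tnth_mktuple.
rewrite (sum_tnth_cons _ _ (fun i => i < j)%N).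
case: (unliftP ord0 j) => [i ->|->] /=; last by rewrite big_pred0// addr0 subr0.
rewrite !tnthS tnth_mktuple opprD addrA; congr (_ * _ / _).
by rewrite [in LHS](tuple_eta v) tnthS.
Qed.

(** The exponent at an index involves only that index and later ones, so dropping the first variable
    leaves it unchanged. *)
Lemma gam_lift n (a b : 'I_n.+1 -> R) j :
  gam a b (lift ord0 j) = gam (a \o lift ord0) (b \o lift ord0) j.
Proof.
rewrite /gam; congr (_ + _ + _); rewrite big_mkcond big_ord_recl /= add0r;
by rewrite [RHS]big_mkcond; apply: eq_bigr.
Qed.

(** The bracket is the power of the simplex size released by the last [n] variables; adding the
    first variable's own exponent yields the first gamma. *)
Lemma gam_ord0 n (a b : 'I_n.+1 -> R) :
  gam a b ord0 = b ord0 + (\sum_i a (lift ord0 i) + \sum_i b (lift ord0 i) + n%:R).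
Proof.
rewrite /gam big_mkcond big_ord_recl /= add0r [X in _ + X + _]big_mkcond.
by rewrite big_ord_recl /= subSS subn0; ring.
Qed.

Lemma betaprod_cons n (a c : 'I_n.+1 -> R) (v : n.+1.-tuple R) x t :
  betaprod a c v (cons_tuple x t) =
  betaker (a ord0) (c ord0) (thead v) x *
  betaprod (a \o lift ord0) (c \o lift ord0) [tuple of behead v] t.
Proof.
rewrite /betaprod big_ord_recl; congr (_ * _); apply: eq_bigr => j _.
by rewrite tnthS [in LHS](tuple_eta v) tnthS.
Qed.
End stick_breaking.

(** * Change of variables at a fixed positive [v] *)

Section change_of_variables.
Context {R : realType}.
Local Notation mu := (@lebesgue_measure R).

(** Under the substitution [x = s / v * u], with Jacobian [s / v], the two powers release [s]^
    a[and]s [^ c], and the Jacobian releases one more [s]. *)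
Lemma betaker_rescale (a c s v u : R) : 0 < s -> 0 < v ->
  s / v * (if (0 < s / v * u) && (s / v * u < s)
           then (s / v * u) `^ a * (s - s / v * u) `^ c else 0) =
  s `^ (a + c + 1) * betaker a c v u.
Proof.
move=> s0 v0; have sv0 : 0 < s / v by rewrite divr_gt0.
have -> : (0 < s / v * u) = (0 < u) by rewrite pmulr_rgt0.
have -> : (s / v * u < s) = (u < v).
  by rewrite -mulrA gtr_pMr// mulrC ltr_pdivrMr// mul1r.
rewrite /betaker; case: ifPn => [/andP[u0 uv]|_]; last by rewrite !mulr0.
have -> : s / v * u = s * (u / v) by rewrite -mulrA [v^-1 * u]mulrC.
have -> : s - s * (u / v) = s * (1 - u / v) by rewrite mulrBr mulr1.
have vV0 : 0 <= v^-1 by rewrite invr_ge0 ltW.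
have uv1 : 0 <= 1 - u / v by rewrite subr_ge0 ler_pdivrMr// mul1r ltW.
rewrite !powRM ?(ltW s0) ?divr_ge0 ?(ltW u0) ?(ltW v0)//.
have sn0 (r : R) : (r == 0) ==> (s != 0) by rewrite (gt_eqF s0) implybT.
by rewrite !powRD// powRr1 ?(ltW s0)//; ring.
Qed.

(** The arbitrary test function [H] makes this a change of variables, and the free size [s] lets the
    induction go through. The power of [s] is the degree of homogeneity of the kernel plus the
    dimension. *)
Lemma iint_stick n (s : R) (a b : 'I_n -> R) (v : n.-tuple R)
    (H : n.-tuple R -> \bar R) :
  0 < s -> (forall j, 0 < tnth v j) ->
  measurable_fun setT H -> (forall t, 0 <= H t)%E ->
  iint (fun t => (simplexker s a b t)%:E * H (stick s t v))%E =
  ((s `^ (\sum_i a i + \sum_i b i + n%:R))%:E *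
   iint (fun u => (betaprod a (gam a b) v u)%:E * H u))%E.
Proof.
elim: n s a b v H => [|n IH] s a b v H s0 v0 mH H0.
  rewrite /= !big_ord0 !addr0 powRr0 /betaprod big_ord0 !mul1e.
  rewrite /simplexker asboolT ?big_ord0 ?mul1e; last by case.
  by congr H; rewrite tuple0.
pose a' := a \o lift ord0; pose b' := b \o lift ord0.
pose v' : n.-tuple R := [tuple of behead v].
have v'0 j : 0 < tnth v' j by have := v0 (lift ord0 j); rewrite {1}(tuple_eta v) tnthS.
have vh0 : 0 < thead v by exact: (v0 ord0).
pose e' := \sum_i a' i + \sum_i b' i + n%:R.
(* The beta kernels of the later coordinates are absorbed into the test function; integrating those
   coordinates out leaves [Psi], a function of the first one alone. *)
pose G (w : n.+1.-tuple R) : \bar R :=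
  ((betaprod a' (gam a' b') v' [tuple of behead w])%:E * H w)%E.
have mG : measurable_fun setT G.
  apply: emeasurable_funM => //; apply/measurable_EFinP.
  by apply: measurable_betaprod => //; exact: measurable_behead.
have G0 w : (0 <= G w)%E by rewrite mule_ge0// lee_fin betaprod_ge0.
pose Psi (x : R) := iint (fun t => G (cons_tuple x t)).
have mPsi : measurable_fun setT Psi by exact: measurable_iint_cons.
have Psi0 x : (0 <= Psi x)%E by exact: iint_ge0.
have behead_cons (x : R) (t : n.-tuple R) : [tuple of behead (cons_tuple x t)] = t.
  exact/val_inj.
(* In the exponent of [s - x], [b ord0] comes from the first coordinate and [e'] from the induction
   hypothesis at size [s - x]; the sum is [gam a b ord0]. *)
pose L (x : R) : R :=
  if (0 < x) && (x < s) then x `^ a ord0 * (s - x) `^ (b ord0 + e') else 0.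
have L0 x : 0 <= L x by rewrite /L; case: ifP => // _; rewrite mulr_ge0 ?powR_ge0.
have mL : measurable_fun setT L.
  apply: measurable_fun_ifT => //.
    by apply: measurable_and; exact: measurable_fun_ltr.
  apply: measurable_funM => //.
  by apply: (measurableT_comp (measurable_powR _)); exact: measurable_funB.
transitivity (\int[mu]_x ((L x)%:E * Psi (thead v / s * x)%R))%E.
  apply: eq_integral => x _.
  pose K : R := if (0 < x) && (x < s) then x `^ a ord0 * (s - x) `^ b ord0 else 0.
  have K0 : 0 <= K by rewrite /K; case: ifP => // _; rewrite mulr_ge0 ?powR_ge0.
  pose Hx (t : n.-tuple R) := H (cons_tuple (thead v * x / s) t).
  have mHx : measurable_fun setT Hx.
    exact: (measurableT_comp mH (measurable_cons_tuple _)).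
  have Hx0 t : (0 <= Hx t)%E by exact: H0.
  transitivity (iint (fun t : n.-tuple R => K%:E *
      ((simplexker (s - x) a' b' t)%:E * Hx (stick (s - x) t v'))))%E.
    by apply: eq_iint => t; rewrite simplexker_cons stick_cons EFinM muleA.
  rewrite iintZl//; last 2 first.
  - apply: emeasurable_funM.
      by apply/measurable_EFinP; exact: measurable_simplexker.
    apply: (measurableT_comp mHx).
    by apply: measurable_stick => //; exact: measurable_id.
  - by move=> t; rewrite mule_ge0// lee_fin simplexker_ge0.
  rewrite /K /L; case: ifPn => [/andP[x0 xs]|_]; last by rewrite !mul0e.
  have sx0 : 0 < s - x by rewrite subr_gt0.
  rewrite IH//.
  have sn0 (r : R) : (r == 0) ==> (s - x != 0) by rewrite (gt_eqF sx0) implybT.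
  rewrite muleA -EFinM; congr (_%:E * _)%E; first by rewrite powRD// mulrA.
  apply: eq_iint => t; rewrite /G behead_cons /Hx.
  by congr (_ * H _)%E; congr cons_tuple; rewrite mulrAC.
have sv0 : 0 < s / thead v by rewrite divr_gt0.
have mLP : measurable_fun setT (fun x : R => (L x)%:E * Psi (thead v / s * x)%R)%E.
  apply: emeasurable_funM; first exact/measurable_EFinP.
  by apply: (measurableT_comp mPsi); exact: measurable_funM.
have mBH : measurable_fun setT (fun w : n.+1.-tuple R =>
    (betaprod a (gam a b) v w)%:E * H w)%E.
  apply: emeasurable_funM => //; apply/measurable_EFinP.
  by apply: measurable_betaprod => //; exact: measurable_id.
(* This scale cancels the factor [thead v / s] in the argument of [Psi]. *)
rewrite (ge0_integral_scale sv0 mLP); last first.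
- by move=> x; apply: mule_ge0 => //; rewrite lee_fin.
rewrite -ge0_integralZl//; last 3 first.
- have mM : measurable_fun setT (fun x : R => s / thead v * x) by exact: measurable_funM.
  by move=> _ Y mY; exact: (measurableT_comp mLP mM).
- by move=> x _; apply: mule_ge0 => //; rewrite lee_fin.
- by rewrite lee_fin ltW.
have BH0 w : (0 <= (betaprod a (gam a b) v w)%:E * H w)%E.
  by rewrite mule_ge0// lee_fin betaprod_ge0.
rewrite /= -ge0_integralZl//; last 3 first.
- have mI := measurable_iint_cons mBH BH0.
  by move=> _ Y mY; exact: mI.
- by move=> x _; apply: iint_ge0 => t; rewrite mule_ge0// lee_fin betaprod_ge0.
- by rewrite lee_fin powR_ge0.
apply: eq_integral => x _.
rewrite muleA -EFinM.
have -> : thead v / s * (s / thead v * x) = x.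
  by field; rewrite !gt_eqF.
rewrite /L betaker_rescale//.
have -> : a ord0 + (b ord0 + e') + 1 = \sum_i a i + \sum_i b i + n.+1%:R.
  by rewrite /e' !big_ord_recl -natr1; ring.
rewrite EFinM -muleA; congr (_ * _)%E.
rewrite /Psi -iintZl//; last 2 first.
- exact: betaker_ge0.
- exact: (measurableT_comp mG (measurable_cons_tuple _)).
apply: eq_iint => t.
rewrite betaprod_cons EFinM /G behead_cons muleA gam_ord0; congr (_ * _ * _)%E.
by congr (betaprod _ _ _ _)%:E; apply/funext => j; rewrite /= gam_lift.
Qed.
End change_of_variables.

(** * The joint density of u *)

Section independent_pair.
Local Open Scope ereal_scope.
Context d d1 d2 (T : measurableType d) (S1 : measurableType d1)
  (S2 : measurableType d2) {R : realType} (P : probability T R).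
Variables (X : {mfun T >-> S1}) (Y : {mfun T >-> S2}).
Hypothesis indepXY : forall A B, measurable A -> measurable B ->
  P (X @^-1` A `&` Y @^-1` B) = P (X @^-1` A) * P (Y @^-1` B).

(** By independence the law of the pair agrees with the product of the marginal laws on rectangles,
    hence everywhere; Tonelli then integrates [X] out first. *)
Lemma ge0_integral_indep (F : S1 * S2 -> \bar R) :
  measurable_fun setT F -> (forall p, 0 <= F p) ->
  \int[P]_w F (X w, Y w) = \int[P]_w \int[distribution P X]_x F (x, Y w).
Proof.
move=> mF F0.
have mXY : measurable_fun setT (fun w => (X w, Y w)).
  by apply: measurable_fun_pair; exact: measurable_funPT.
transitivity (\int[pushforward P (fun w => (X w, Y w))]_p F p).
  by rewrite ge0_integral_pushforward.
transitivity (\int[distribution P X \x distribution P Y]_p F p).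
  apply: eq_measure_integral => A mA _; apply/esym.
  by apply: product_measure_unique => // B C mB mC; exact: indepXY.
rewrite fubini_tonelli2// ge0_integral_pushforward//.
- exact: measurable_fun_fubini_tonelli_G.
- by move=> y _; apply: integral_ge0.
Qed.
End independent_pair.

(** * Sign of iterated integrals and the Beta integral *)

Section integral_extra.
Local Open Scope ereal_scope.

Lemma integral_indicM d (T : measurableType d) (R : realType)
    (m : {measure set T -> \bar R}) (A : set T) (F : T -> \bar R) :
  \int[m]_(x in A) F x = \int[m]_x ((\1_A x)%:E * F x).
Proof.
rewrite integral_mkcond; apply: eq_integral => x _.
by rewrite patchE indicE; case: (x \in A); rewrite ?mul1e ?mul0e.
Qed.

(** This serves to exclude a negative normalizing constant, whose sign is not assumed. *)
Lemma iint_le0 (R : realType) n (F : n.-tuple R -> \bar R) :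
  (forall t, F t <= 0) -> iint F <= 0.
Proof.
elim: n F => [|n IH] F F0 /=; first exact: F0.
have -> : \int[lebesgue_measure]_x iint (fun t => F (cons_tuple x t)) =
    - \int[lebesgue_measure]_x - iint (fun t => F (cons_tuple x t)).
  rewrite -integral_ge0N; first by under [RHS]eq_integral do rewrite oppeK.
  by move=> x _; rewrite oppe_ge0; exact: IH.
by rewrite oppe_le0; apply: integral_ge0 => x _; rewrite oppe_ge0; exact: IH.
Qed.

(** The bounds on [a] and [c] make all three Gamma values finite and positive, so the convolution
    identity can be divided by the one on its right-hand side. *)
Lemma integral_betaker (R : realType) (a c : R) : (-1 < a)%R -> (0 < c)%R ->
  \int[lebesgue_measure]_u (betaker a (c - 1) 1 u)%:E =
  (Gamma (a + 1) * Gamma c / Gamma (a + c + 1))%:E.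
Proof.
move=> a1 c0; have a10 : (0 < a + 1)%R by lra.
have ac0 : (0 < a + c + 1)%R by lra.
have := gammaint_betaker a (c - 1).
rewrite subrK (_ : a + (c - 1) + 2 = a + c + 1)%R; last by ring.
rewrite -!EFin_Gamma// => /(congr1 (fun z => (Gamma (a + c + 1))^-1%:E * z)).
rewrite -!EFinM muleA -EFinM mulVf ?gt_eqF ?Gamma_gt0// mul1e => <-.
by rewrite mulrC.
Qed.
End integral_extra.

(** * Law of [u] and evaluation of the simplex integral *)

Section joint_density.
Context {R : realType}.

(* The exponents of [f1dens]: the last beta is lowered by one. *)
Definition dec_last k (beta : 'I_k -> R) (j : 'I_k) : R :=
  if j.+1 == k then beta j - 1 else beta j.

(** The last index lies in every range of indices from [j] on, so lowering the last beta lowers each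
    gamma by exactly one. This produces the exponents of the Kober kernel. *)
Lemma gam_dec_last k (alpha beta : 'I_k -> R) j :
  gam alpha (dec_last beta) j = gam alpha beta j - 1.
Proof.
case: k => [|k] in alpha beta j *; first by case: j.
rewrite /gam.
have -> : \sum_(i < k.+1 | (j <= i)%N) dec_last beta i =
    \sum_(i < k.+1 | (j <= i)%N) beta i - 1.
  have jm : (j <= (ord_max : 'I_k.+1))%N by rewrite -ltnS.
  rewrite (bigD1 ord_max)//= [X in _ = X - 1](bigD1 ord_max)//=.
  rewrite {1}/dec_last eqxx addrAC; congr (_ + _ - _); apply: eq_bigr => i /andP[_ im].
  rewrite /dec_last ifF//; apply: contraNF im => /eqP[ik].
  by apply/eqP/val_inj.
ring.
Qed.

(** Only the supports differ in form: positive coordinates already force positive partial sums. *)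
Lemma f1dens_simplexker k (alpha beta : 'I_k -> R) C1 t :
  f1dens alpha beta C1 t = C1 * simplexker 1 alpha (dec_last beta) t.
Proof.
rewrite /f1dens /simplexker.
have <- : `[< forall j, 0 < tnth t j /\ 0 < psum t j < 1 >] =
    `[< forall j, 0 < tnth t j /\ psum t j < 1 >].
  apply: asbool_equiv_eq; split=> H j; have [tj pj] := H j; split=> //.
    by case/andP: pj.
  rewrite pj andbT /psum (bigD1 j)//= ltr_wpDr// sumr_ge0// => i _.
  by have [/ltW] := H i.
by case: asboolP => // _; rewrite mulr0.
Qed.

(** Collecting the powers of [y] in each beta kernel gives the exponent [- alpha j - c j], the
    powers of [u] factor out, and both sides vanish unless [u] lies below [y] in every
    coordinate. *)
Lemma betaprod_Kober k (alpha c : 'I_k -> R) f (u y : k.-tuple R) :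
  (forall j, 0 < tnth u j) ->
  betaprod alpha (fun j => c j - 1) y u * f y =
  \prod_(j < k) (tnth u j `^ alpha j) * Kober_integrand alpha c f u y.
Proof.
move=> u0; rewrite /Kober_integrand; case: asboolP => H; last first.
  rewrite mulr0; apply/eqP; rewrite mulf_eq0; apply/orP; left.
  have [j uj] : exists j, ~ tnth u j < tnth y j by apply/existsNP.
  apply/prodf_eq0; exists j => //; rewrite /betaker.
  by move/negP/negbTE: uj => ->; rewrite andbF.
rewrite mulrA; congr (_ * _); rewrite -big_split; apply: eq_bigr => j _ /=.
have := u0 j; have := H j; move: (tnth u j) (tnth y j) => uj yj uy uj0.
have yj0 : 0 < yj by exact: lt_trans uy.
rewrite /betaker uj0 uy /=.
have yn0 (r : R) : (r == 0) ==> (yj != 0) by rewrite (gt_eqF yj0) implybT.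
have -> : yj `^ (- alpha j - c j) = yj^-1 `^ alpha j * yj^-1 `^ (c j - 1) * yj^-1.
  rewrite -(powR_inv1 (ltW yj0)) -!powRrM -!powRD//.
  by congr (_ `^ _); ring.
have -> : 1 - uj / yj = (yj - uj) * yj^-1 by rewrite mulrBl divff// gt_eqF.
have yV0 : 0 <= yj^-1 by rewrite invr_ge0 ltW.
have yu0 : 0 <= yj - uj by rewrite subr_ge0 ltW.
rewrite !powRM ?(ltW uj0)//; ring.
Qed.

(** The substitution at size 1, with all [v] equal to 1 and constant test function 1, splits the
    integral into one-dimensional Beta integrals. *)
Lemma iint_simplexker k (alpha beta : 'I_k -> R) :
  (forall j, -1 < alpha j) -> (forall j, 0 < gam alpha beta j) ->
  iint (fun t => (simplexker 1 alpha (dec_last beta) t)%:E) =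
  (\prod_(j < k) (Gamma (alpha j + 1) * Gamma (gam alpha beta j) /
                  Gamma (alpha j + gam alpha beta j + 1)))%:E.
Proof.
move=> a1 g0; pose one : k.-tuple R := [tuple 1 | j < k].
have := @iint_stick R k 1 alpha (dec_last beta) one (cst 1%E) ltr01.
rewrite powR1 mul1e (_ : gam alpha (dec_last beta) = fun j => gam alpha beta j - 1);
  last by apply/funext => j; exact: gam_dec_last.
move=> /(_ _ _ _)/= H; rewrite (eq_iint (G := fun t =>
  (simplexker 1 alpha (dec_last beta) t)%:E * 1)%E); last by move=> t; rewrite mule1.
rewrite H//; last by move=> j; rewrite tnth_mktuple.
rewrite (eq_iint (G := fun u : k.-tuple R =>
  (\prod_(j < k) betaker (alpha j) (gam alpha beta j - 1) 1 (tnth u j))%:E)).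
  rewrite (iint_prod (w := fun j => betaker (alpha j) (gam alpha beta j - 1) 1)); last 2 first.
  - by move=> j x; exact: betaker_ge0.
  - by move=> j; apply: measurable_betaker => //; exact: measurable_id.
  rewrite (big_morph EFin (@EFinM R) (erefl 1%:E)).
  by apply: eq_bigr => j _; exact: integral_betaker.
by move=> u; rewrite mule1 /betaprod; congr EFin; apply: eq_bigr => j _; rewrite tnth_mktuple.
Qed.

Local Open Scope ereal_scope.

(** Independence allows [X] to be integrated out at a fixed value [y] of [V], where [iint_stick]
    applies; the law of [V] is then replaced by its density and the two integrals are exchanged. *)
Lemma product_law d (T : measurableType d) (P : probability T R) k
    (alpha beta : 'I_k -> R) (C1 : R) (X V : {mfun T >-> k.-tuple R})
    (f : k.-tuple R -> R) :
  (0 <= C1)%R ->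
  (forall A, measurable A -> P (X @^-1` A) = \int[lebtuple k]_(t in A) (f1dens alpha beta C1 t)%:E) ->
  (forall w j, (0 < tnth (V w) j)%R) ->
  measurable_fun setT f -> (forall t, (0 <= f t)%R) ->
  (forall A, measurable A -> P (V @^-1` A) = \int[lebtuple k]_(t in A) (f t)%:E) ->
  (forall A B, measurable A -> measurable B ->
     P (X @^-1` A `&` V @^-1` B) = P (X @^-1` A) * P (V @^-1` B)) ->
  forall A, measurable A ->
  P ((fun w => utrans (X w) (V w)) @^-1` A) =
  \int[lebtuple k]_(u in A) \int[lebtuple k]_y
    (C1 * betaprod alpha (fun j => gam alpha beta j - 1) y u * f y)%:E.
Proof.
move=> C0 PX V0 mf f0 PV ind A mA.
set c := fun j => (gam alpha beta j - 1)%R.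
have mU : measurable_fun setT (fun p : k.-tuple R * k.-tuple R => utrans p.1 p.2).
  exact: (measurable_stick 1 measurable_fst measurable_snd).
pose F (p : k.-tuple R * k.-tuple R) : \bar R := (\1_A (utrans p.1 p.2))%:E.
have m1A : measurable_fun setT (fun t : k.-tuple R => (\1_A t : R)%:E).
  by apply/measurable_EFinP; exact: measurable_indic.
have mF : measurable_fun setT F by exact: (measurableT_comp m1A mU).
have F0 p : 0 <= F p by rewrite lee_fin.
have mXV : measurable_fun setT (fun w => utrans (X w) (V w)).
  exact: (measurable_stick 1).
have mE : measurable ((fun w => utrans (X w) (V w)) @^-1` A).
  by rewrite -[X in measurable X]setTI; exact: mXV.
have mf1 : measurable_fun setT (f1dens alpha beta C1).
  rewrite (_ : f1dens _ _ _ = fun t => (C1 * simplexker 1 alpha (dec_last beta) t)%R).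
    by apply: measurable_funM => //; exact: measurable_simplexker.
  by apply/funext => t; exact: f1dens_simplexker.
have f10 t : (0 <= f1dens alpha beta C1 t)%R.
  by rewrite f1dens_simplexker mulr_ge0// simplexker_ge0.
(* For positive [y] this is the conditional probability that [u] lies in [A] given that [V] equals
   [y]. *)
pose Phi y := C1%:E * \int[lebtuple k]_u ((betaprod alpha c y u)%:E * (\1_A u)%:E).
have mbp : measurable_fun setT (fun p : k.-tuple R * k.-tuple R => betaprod alpha c p.1 p.2).
  exact: (measurable_betaprod _ _ measurable_fst measurable_snd).
have mB : measurable_fun setT (fun p : k.-tuple R * k.-tuple R =>
    (betaprod alpha c p.1 p.2)%:E * (\1_A p.2)%:E).
  apply: emeasurable_funM; first exact/measurable_EFinP.
  exact: (measurableT_comp m1A measurable_snd).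
have B0 p : 0 <= (betaprod alpha c p.1 p.2)%:E * (\1_A p.2 : R)%:E.
  by rewrite mule_ge0// lee_fin// betaprod_ge0.
have mPhi : measurable_fun setT Phi.
  by apply: measurable_funeM; exact: measurable_fun_fubini_tonelli_F mB _.
have Phi0 y : 0 <= Phi y.
  by rewrite mule_ge0// integral_ge0// => u _; exact: (B0 (y, u)).
transitivity (\int[P]_w F (X w, V w)).
  rewrite (eq_integral (fun w => (\1_((fun w => utrans (X w) (V w)) @^-1` A) w)%:E))//.
  by rewrite integral_indic// setIT.
rewrite ge0_integral_indep//.
transitivity (\int[P]_w Phi (V w)).
  (* Positivity of every value of [V] is what permits the substitution here. *)
  apply: eq_integral => w _; move: (V w) (V0 w) => y y0.
  have mFy : measurable_fun setT (fun x => F (x, y)).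
    exact: (measurableT_comp mF (pair2_measurable y)).
  have m1y : measurable_fun setT (fun t => (simplexker 1 alpha (dec_last beta) t)%:E *
      (\1_A (stick 1 t y))%:E).
    apply: emeasurable_funM => //.
    by apply/measurable_EFinP; exact: measurable_simplexker.
  have n1y t : 0 <= (simplexker 1 alpha (dec_last beta) t)%:E * (\1_A (stick 1 t y))%:E.
    by rewrite mule_ge0// lee_fin// simplexker_ge0.
  rewrite (ge0_integral_density (m := lebtuple k) mf1 f10)//.
  transitivity (iint (fun t => C1%:E * ((simplexker 1 alpha (dec_last beta) t)%:E *
      (\1_A (stick 1 t y))%:E))).
    rewrite iintE; last 2 first.
    - exact: measurable_funeM.
    - by move=> t; rewrite mule_ge0.
    by apply: eq_integral => t _; rewrite f1dens_simplexker EFinM muleC -muleA.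
  rewrite iintZl//.
  rewrite (@iint_stick R k 1 alpha (dec_last beta) y (fun u => (\1_A u)%:E))//.
  rewrite powR1 mul1e /Phi iintE.
  - congr (_ * _); apply: eq_integral => u _; congr (_%:E * _).
    by apply: eq_bigr => j _; rewrite gam_dec_last.
  - apply: emeasurable_funM => //; apply/measurable_EFinP.
    by apply: measurable_betaprod => //; exact: measurable_id.
  - by move=> u; rewrite mule_ge0// lee_fin// betaprod_ge0.
transitivity (\int[distribution P V]_y Phi y).
  by rewrite ge0_integral_pushforward.
rewrite (ge0_integral_density (m := lebtuple k) mf f0)//.
pose G (p : k.-tuple R * k.-tuple R) : \bar R :=
  (\1_A p.2)%:E * (C1 * betaprod alpha c p.1 p.2 * f p.1)%:E.
have mG : measurable_fun setT G.
  apply: emeasurable_funM; first exact: (measurableT_comp m1A measurable_snd).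
  apply/measurable_EFinP; apply: measurable_funM; first exact: measurable_funM.
  exact: (measurableT_comp mf measurable_fst).
have G0 p : 0 <= G p.
  by rewrite mule_ge0// lee_fin// !mulr_ge0// betaprod_ge0.
transitivity (\int[lebtuple k]_y \int[lebtuple k]_u G (y, u)).
  apply: eq_integral => y _; rewrite /Phi.
  have mBy : measurable_fun setT (fun u => (betaprod alpha c y u)%:E * (\1_A u)%:E).
    exact: (measurableT_comp mB (pair1_measurable y)).
  rewrite muleAC -EFinM -ge0_integralZl//; last 2 first.
  - by move=> u _; exact: (B0 (y, u)).
  - by rewrite lee_fin mulr_ge0.
  apply: eq_integral => u _; by rewrite /G /= -!EFinM; congr EFin; ring.
rewrite (fubini_tonelli G)// [RHS]integral_indicM; apply: eq_integral => u _.
rewrite -ge0_integralZl//.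
- apply/measurable_EFinP; apply: measurable_funM => //; apply: measurable_funM => //.
  by apply: measurable_betaprod => //; exact: measurable_id.
- by move=> y _; rewrite lee_fin !mulr_ge0// betaprod_ge0.
Qed.
End joint_density.

(** * Identification of [g] with the Kober integral *)

Unset Implicit Arguments.
Set Strict Implicit.

Theorem theorem1p3 (R : realType) (k : nat) (alpha beta : 'I_k -> R) (C1 : R)
  (d : measure_display) (T : measurableType d) (P : probability T R)
  (x v : T -> k.-tuple R) (f g : k.-tuple R -> R) :
  (0 < k)%N ->
  (forall j, -1 < alpha j) ->
  (forall j, 0 < gam alpha beta j) ->
  measurable_fun setT x -> measurable_fun setT v ->
  (* x has joint density f_1 *)
  (forall A : set (k.-tuple R), measurable A ->
     P (x @^-1` A) = iint (fun t => ((\1_A t : R) * f1dens alpha beta C1 t)%:E)) ->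
  (* v is a vector of positive random variables with joint density f *)
  (forall w, forall j, 0 < tnth (v w) j) ->
  measurable_fun setT f -> (forall t, 0 <= f t) ->
  (forall A : set (k.-tuple R), measurable A ->
     P (v @^-1` A) = iint (fun t => ((\1_A t : R) * f t)%:E)) ->
  (* x and v are independent *)
  (forall A B : set (k.-tuple R), measurable A -> measurable B ->
     P (x @^-1` A `&` v @^-1` B) = (P (x @^-1` A) * P (v @^-1` B))%E) ->
  (* g is the joint density of u = (u_1, ..., u_k) *)
  measurable_fun setT g -> (forall t, 0 <= g t) ->
  (forall A : set (k.-tuple R), measurable A ->
     P ((fun w => utrans (x w) (v w)) @^-1` A) =
       iint (fun t => ((\1_A t : R) * g t)%:E)) ->
  (* conclusion, for almost every u in (0, oo)^k *)
  exists N : set (k.-tuple R), measurable N /\ lebn N = 0%E /\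
    forall u : k.-tuple R, (forall j, 0 < tnth u j) -> ~ N u ->
      ((\prod_(j < k) (Gamma (alpha j + 1) /
                       Gamma (alpha j + gam alpha beta j + 1))) * g u)%:E =
      Kober alpha (gam alpha beta) f u.

Proof.
move=> _ a1 g0 mx mv Px v0 mf f0 Pv ind mg g_ge0 Pu.
pose X : {mfun T >-> k.-tuple R} := HB.pack x (isMeasurableFun.Build _ _ _ _ x mx).
pose V : {mfun T >-> k.-tuple R} := HB.pack v (isMeasurableFun.Build _ _ _ _ v mv).
have m1 (A : set (k.-tuple R)) : measurable A ->
    measurable_fun setT (fun t : k.-tuple R => (\1_A t : R)).
  by move=> mA; exact: measurable_indic.
have mf1 : measurable_fun setT (f1dens alpha beta C1).
  rewrite (_ : f1dens _ _ _ = fun t => (C1 * simplexker 1 alpha (dec_last beta) t)%R).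
    by apply: measurable_funM => //; exact: measurable_simplexker.
  by apply/funext => t; exact: f1dens_simplexker.
(* A negative constant would give the whole space nonpositive probability. *)
have C1_ge0 : 0 <= C1.
  rewrite leNgt; apply/negP => C1_lt0.
  have := Px setT measurableT; rewrite preimage_setT probability_setT => /eqP.
  apply/negP; rewrite gt_eqF//; apply: le_lt_trans (lte01).
  apply: iint_le0 => t; rewrite lee_fin indicT mul1r f1dens_simplexker.
  by rewrite mulr_le0_ge0 ?(ltW C1_lt0)// simplexker_ge0.
have f1_ge0 t : 0 <= f1dens alpha beta C1 t.
  by rewrite f1dens_simplexker mulr_ge0// simplexker_ge0.
have iint_indicM (A : set (k.-tuple R)) (h : k.-tuple R -> R) : measurable A ->
    measurable_fun setT h -> (forall t, 0 <= h t) ->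
    iint (fun t => ((\1_A t : R) * h t)%:E) = (\int[lebtuple k]_(t in A) (h t)%:E)%E.
  move=> mA mh h0; rewrite iintE; last 2 first.
  - by apply/measurable_EFinP; apply: measurable_funM => //; exact: m1.
  - by move=> t; rewrite lee_fin mulr_ge0.
  by rewrite [RHS]integral_indicM; apply: eq_integral => t _; rewrite EFinM.
(* Total mass one, combined with the evaluated simplex integral, determines [C1]. *)
have C1E : C1 * \prod_(j < k) (Gamma (alpha j + 1) * Gamma (gam alpha beta j) /
    Gamma (alpha j + gam alpha beta j + 1)) = 1.
  apply: EFin_inj; rewrite EFinM -iint_simplexker// -iintZl//.
  - rewrite -[RHS](probability_setT P) -(preimage_setT x) Px//.
    by apply: eq_iint => t; rewrite indicT mul1r f1dens_simplexker.
  - by apply/measurable_EFinP; exact: measurable_simplexker.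
  - by move=> t; rewrite lee_fin simplexker_ge0.
pose c j := gam alpha beta j - 1.
(* The explicit density is kept extended-real: its finiteness is only obtained almost everywhere,
   from the comparison with [g]. *)
pose h (u : k.-tuple R) := (\int[lebtuple k]_y
  (C1 * betaprod alpha c y u * f y)%:E)%E.
have Pu_h (A : set (k.-tuple R)) : measurable A ->
    (\int[lebtuple k]_(u in A) (g u)%:E = \int[lebtuple k]_(u in A) h u)%E.
  move=> mA; rewrite -iint_indicM// -Pu//.
  apply: (@product_law _ _ _ P k alpha beta C1 X V f) => //.
  - by move=> B mB; rewrite [LHS]Px// iint_indicM.
  - by move=> B mB; rewrite [LHS]Pv// iint_indicM.
have mh : measurable_fun setT h.
  have mG : measurable_fun setT (fun p : k.-tuple R * k.-tuple R =>
      (C1 * betaprod alpha c p.2 p.1 * f p.2)%:E).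
    apply/measurable_EFinP; apply: measurable_funM.
      apply: measurable_funM => //.
      exact: (measurable_betaprod _ _ measurable_snd measurable_fst).
    exact: (measurableT_comp mf measurable_snd).
  apply: (measurable_fun_fubini_tonelli_F (m2 := lebtuple k) _ mG) => p.
  by rewrite lee_fin !mulr_ge0// betaprod_ge0.
(* [g] is integrable with integral 1, and [h] has the same integral over every measurable set. *)
have gh : ae_eq (lebtuple k) setT (EFin \o g) h.
  apply: integral_ae_eq => //; last by move=> A _; exact: Pu_h.
  apply/integrableP; split; first exact/measurable_EFinP.
  rewrite (eq_integral (EFin \o g)); last by move=> t _; rewrite gee0_abs ?lee_fin.
  by rewrite -iint_indicM// -Pu// preimage_setT probability_setT ltry.
have [N [mN N0 sN]] := gh.
exists N; split => //; split.
  rewrite /lebn iintE; last by move=> t; rewrite lee_fin.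
    by rewrite integral_indic// setIT.
  by apply/measurable_EFinP; exact: m1.
move=> u u0 uN.
have gu : (g u)%:E = h u by apply: contrapT => guh; apply: uN; apply: sN => /(_ I).
set I := iint (fun y => (Kober_integrand alpha (gam alpha beta) f u y)%:E).
set Q := \prod_(j < k) (tnth u j `^ alpha j).
have Q0 : 0 < Q by apply: prodr_gt0 => j _; rewrite powR_gt0.
have huE : h u = ((C1 * Q)%:E * I)%E.
  have KE y : Kober_integrand alpha (gam alpha beta) f u y =
      Q^-1 * (betaprod alpha c y u * f y).
    by rewrite betaprod_Kober// mulrA mulVf ?mul1r// gt_eqF.
  rewrite /I -iintZl ?mulr_ge0 ?(ltW Q0)//; last 2 first.
  - rewrite (_ : (fun y => _) = fun y => (Q^-1 * (betaprod alpha c y u * f y))%:E).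
      apply/measurable_EFinP; apply: measurable_funM => //; apply: measurable_funM => //.
      by apply: measurable_betaprod => //; exact: measurable_id.
    by apply/funext => y; rewrite KE.
  - move=> y; rewrite KE lee_fin mulr_ge0 ?invr_ge0 ?(ltW Q0)//.
    by rewrite mulr_ge0// betaprod_ge0.
  rewrite (eq_iint (G := fun y => (C1 * betaprod alpha c y u * f y)%:E)).
    rewrite iintE//.
      apply/measurable_EFinP; apply: measurable_funM => //; apply: measurable_funM => //.
      by apply: measurable_betaprod => //; exact: measurable_id.
    by move=> y; rewrite lee_fin !mulr_ge0// betaprod_ge0.
  by move=> y; rewrite -EFinM KE; congr EFin; field; rewrite gt_eqF.
rewrite EFinM gu huE /Kober -/I muleA -EFinM; congr (_%:E * _)%E.
rewrite /Kober_pre.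
have ag j : 0 < alpha j + gam alpha beta j + 1 by have := a1 j; have := g0 j; lra.
have a10 j : 0 < alpha j + 1 by have := a1 j; lra.
(* Inserting the product equal to 1 by [C1E] cancels each [Gamma (gam alpha beta j)] of the Kober
   prefactor and leaves the required Gamma ratios. *)
transitivity (C1 * \prod_(j < k) (Gamma (alpha j + 1) * Gamma (gam alpha beta j) /
    Gamma (alpha j + gam alpha beta j + 1)) *
  \prod_(j < k) (tnth u j `^ alpha j / Gamma (gam alpha beta j))); last by rewrite C1E mul1r.
rewrite /Q mulrCA -!mulrA; congr (_ * _); rewrite -!big_split; apply: eq_bigr => j _ /=.
by field; rewrite !gt_eqF ?Gamma_gt0.
Qed.
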